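(* Let $\Gamma_1,\Gamma_2$ be finite multisets of formulas and $\Delta$ a multiset containing at most one formula. If $\mathbf{iK_d} \vdash \Gamma_1 , \Gamma_2 \Rightarrow \Delta$, then there is a formula $C \in \mathcal{L}$ such that: (i) $\mathbf{iK_d} \vdash \Gamma_1 \Rightarrow C$, (ii) $\mathbf{iK_d} \vdash \Gamma_2 , C \Rightarrow \Delta$, and (iii) $V(C) \subseteq V(\Gamma_1) \cap V(\Gamma_2 \cup \Delta)$. Consequently, the logic $\mathsf{iK_d}$ has the Craig interpolation property: for any formulas $A$ and $B$, if $(A \to B) \in \mathsf{iK_d}$, then there exists a formula $C$ such that $(A \to C) \in \mathsf{iK_d}$, $(C \to B) \in \mathsf{iK_d}$ and $V(C) \subseteq V(A) \cap V(B)$.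
   Context: Language and sequents. Fix a set $V$ of atomic propositions. $\mathcal{L}$-formulas (simply ''formulas'') are built from atoms in $V$ and the constants $\top,\bot$ using binary connectives $\wedge,\vee,\supset,\to$ and the unary connective $\nabla$. $V(A)$ is the set of atoms occurring in $A$ and $V(\Gamma)=\bigcup_{\gamma\in\Gamma}V(\gamma)$. $\nabla^n A$ is the $n$-fold application of $\nabla$ to $A$, and $\nabla^n\Gamma$ is the multiset $\{\nabla^n A \mid A\in\Gamma\}$. A sequent is an expression $\Gamma\Rightarrow\Delta$ with $\Gamma,\Delta$ finite multisets of formulas, $\Delta$ containing at most one formula. Comma is multiset union; a formula stands for its singleton. Rules are written ''premises / conclusion''; $\Gamma,\Sigma$ are arbitrary finite multisets, $\Delta$ has at most one formula, $A,B$ are arbitrary formulas, $n\ge 0$ is an arbitrary natural number. Calculus $\mathbf{iK_d}$. Axioms: $(Id^p)$ $p\Rightarrow p$ for $p$ an atom; $(L\bot)$ $\bot\Rightarrow$; $(R\top)$ $\Rightarrow\top$. $(LW)$ $\Gamma\Rightarrow\Delta$ / $\Gamma,\Sigma\Rightarrow\Delta$. $(Rw)$ $\Gamma\Rightarrow$ / $\Gamma\Rightarrow A$. $(L\wedge^n)$ $\Gamma,\nabla^nA,\nabla^nB\Rightarrow\Delta$ / $\Gamma,\nabla^n(A\wedge B)\Rightarrow\Delta$. $(R\wedge)$ $\Gamma\Rightarrow A$ and $\Gamma\Rightarrow B$ / $\Gamma\Rightarrow A\wedge B$. $(L\vee^n)$ $\Gamma,\nabla^nA\Rightarrow\Delta$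 and $\Gamma,\nabla^nB\Rightarrow\Delta$ / $\Gamma,\nabla^n(A\vee B)\Rightarrow\Delta$. $(R\vee_1)$ $\Gamma\Rightarrow A$ / $\Gamma\Rightarrow A\vee B$. $(R\vee_2)$ $\Gamma\Rightarrow B$ / $\Gamma\Rightarrow A\vee B$. $(L\to^n)$ $\Gamma,\nabla^{n+1}(A\to B)\Rightarrow\nabla^nA$ and $\Gamma,\nabla^{n+1}(A\to B),\nabla^nB\Rightarrow\Delta$ / $\Gamma,\nabla^{n+1}(A\to B)\Rightarrow\Delta$. $(R\to)$ $\nabla\Gamma,A\Rightarrow B$ / $\Gamma\Rightarrow A\to B$. $(L\supset^n)$ $\Gamma,\nabla^n(A\supset B)\Rightarrow\nabla^nA$ and $\Gamma,\nabla^nB\Rightarrow\Delta$ / $\Gamma,\nabla^n(A\supset B)\Rightarrow\Delta$. $(R\supset)$ $\Gamma,A\Rightarrow B$ / $\Gamma\Rightarrow A\supset B$. $(N)$ $\Gamma\Rightarrow\Delta$ / $\nabla\Gamma\Rightarrow\nabla\Delta$. Calculus $\mathbf{STL(N,H)}$. Axioms: $(Id)$ $A\Rightarrow A$; $(L\bot)$ $\bot\Rightarrow$; $(R\top)$ $\Rightarrow\top$. $(Lw)$ $\Gamma\Rightarrow\Delta$ / $\Gamma,A\Rightarrow\Delta$. $(Rw)$ $\Gamma\Rightarrow$ / $\Gamma\Rightarrow A$. $(Lc)$ $\Gamma,A,A\Rightarrow\Delta$ / $\Gamma,A\Rightarrow\Delta$. $(cut)$ $\Gamma\Rightarrow A$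 and $\Sigma,A\Rightarrow\Delta$ / $\Sigma,\Gamma\Rightarrow\Delta$. $(L\wedge_1)$ $\Gamma,A\Rightarrow\Delta$ / $\Gamma,A\wedge B\Rightarrow\Delta$. $(L\wedge_2)$ $\Gamma,B\Rightarrow\Delta$ / $\Gamma,A\wedge B\Rightarrow\Delta$. $(R\wedge)$ $\Gamma\Rightarrow A$ and $\Gamma\Rightarrow B$ / $\Gamma\Rightarrow A\wedge B$. $(L\vee)$ $\Gamma,A\Rightarrow\Delta$ and $\Gamma,B\Rightarrow\Delta$ / $\Gamma,A\vee B\Rightarrow\Delta$. $(R\vee_1)$ $\Gamma\Rightarrow A$ / $\Gamma\Rightarrow A\vee B$. $(R\vee_2)$ $\Gamma\Rightarrow B$ / $\Gamma\Rightarrow A\vee B$. $(N)$ $\Gamma\Rightarrow\Delta$ / $\nabla\Gamma\Rightarrow\nabla\Delta$. $(L\to)$ $\Gamma\Rightarrow A$ and $\Gamma,B\Rightarrow\Delta$ / $\Gamma,\nabla(A\to B)\Rightarrow\Delta$. $(R\to)$ $\nabla\Gamma,A\Rightarrow B$ / $\Gamma\Rightarrow A\to B$. $(L\supset)$ $\Gamma\Rightarrow A$ and $\Gamma,B\Rightarrow\Delta$ / $\Gamma,A\supset B\Rightarrow\Delta$. $(R\supset)$ $\Gamma,A\Rightarrow B$ / $\Gamma\Rightarrow A\supset B$. For a calculus $G$, $G\vdash S$ means that the sequent $S$ has a proof-tree in $G$ (without assumptions). The logic $\mathsf{iK_d}$ is the set of formulas $A$ such that $\mathbf{STL(N,H)}\vdash\,\Rightarrow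 A$. *)

(* Defs.v *)
From Stdlib Require Import List Permutation.
Import ListNotations.

Set Implicit Arguments.

Inductive formula (V : Type) : Type :=
| Atom (p : V)
| Top
| Bot
| And (A B : formula V)
| Or (A B : formula V)
| Imp (A B : formula V)  (* the connective [⊃] *)
| Arr (A B : formula V)  (* the connective [→] *)
| Nabla (A : formula V).

Arguments Top {V}.
Arguments Bot {V}.

Declare Scope formula_scope.
Delimit Scope formula_scope with F.
Bind Scope formula_scope with formula.

Notation "⊤" := Top : formula_scope.
Notation "⊥" := Bot : formula_scope.
Notation "A ∧ B" := (And A B) (at level 40, left associativity) : formula_scope.
Notation "A ∨ B" := (Or A B) (at level 45, left associativity) : formula_scope.
Notation "A ⊃ B" := (Imp A B) (at level 48, right associativity) : formula_scope.
Notation "A → B" := (Arr A B) (at level 48, right associativity) : formula_scope.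
Notation "∇ A" := (Nabla A) (at level 35, right associativity) : formula_scope.
Notation "∇^ n A" := (Nat.iter n (@Nabla _) A)
  (at level 35, n at level 9, A at level 35, right associativity)
  : formula_scope.

(* Multisets of formulas are lists up to [Permutation]: both calculi below have
   an exchange rule, so derivability depends only on the multiset underlying an
   antecedent.  A succedent has at most one formula, hence is an [option]. *)
Definition ctx (V : Type) : Type := list (formula V).
Definition succedent (V : Type) : Type := option (formula V).

Definition nabla_ctx {V} (G : ctx V) : ctx V := map (@Nabla V) G.
Definition nabla_succ {V} (D : succedent V) : succedent V := option_map (@Nabla V) D.

Definition ctx_of_succ {V} (D : succedent V) : ctx V :=
  match D with Some A => [A] | None => [] end.

Fixpoint occurs {V} (p : V) (A : formula V) : Prop :=
  match A with
  | Atom q => p = q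
  | Top | Bot => False
  | And B C | Or B C | Imp B C | Arr B C => occurs p B \/ occurs p C
  | Nabla B => occurs p B
  end.

Definition occurs_ctx {V} (p : V) (G : ctx V) : Prop :=
  exists A, In A G /\ occurs p A.

Local Open Scope formula_scope.

Inductive iKd {V : Type} : ctx V -> succedent V -> Prop :=
| iKd_exchange G G' D : Permutation G G' -> iKd G D -> iKd G' D
| iKd_Id p : iKd [Atom p] (Some (Atom p))
| iKd_LBot : iKd [⊥] None
| iKd_RTop : iKd [] (Some ⊤)
| iKd_LW G S D : iKd G D -> iKd (G ++ S) D
| iKd_Rw G A : iKd G None -> iKd G (Some A)
| iKd_LAnd n G A B D :
    iKd (∇^n A :: ∇^n B :: G) D -> iKd (∇^n (A ∧ B) :: G) D
| iKd_RAnd G A B :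
    iKd G (Some A) -> iKd G (Some B) -> iKd G (Some (A ∧ B))
| iKd_LOr n G A B D :
    iKd (∇^n A :: G) D -> iKd (∇^n B :: G) D -> iKd (∇^n (A ∨ B) :: G) D
| iKd_ROr1 G A B : iKd G (Some A) -> iKd G (Some (A ∨ B))
| iKd_ROr2 G A B : iKd G (Some B) -> iKd G (Some (A ∨ B))
| iKd_LArr n G A B D :
    iKd (∇^(S n) (A → B) :: G) (Some (∇^n A)) ->
    iKd (∇^n B :: ∇^(S n) (A → B) :: G) D ->
    iKd (∇^(S n) (A → B) :: G) D
| iKd_RArr G A B :
    iKd (A :: nabla_ctx G) (Some B) -> iKd G (Some (A → B))
| iKd_LImp n G A B D :
    iKd (∇^n (A ⊃ B) :: G) (Some (∇^n A)) ->
    iKd (∇^n B :: G) D ->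
    iKd (∇^n (A ⊃ B) :: G) D
| iKd_RImp G A B : iKd (A :: G) (Some B) -> iKd G (Some (A ⊃ B))
| iKd_N G D : iKd G D -> iKd (nabla_ctx G) (nabla_succ D).

Inductive STL_NH {V : Type} : ctx V -> succedent V -> Prop :=
| STL_exchange G G' D : Permutation G G' -> STL_NH G D -> STL_NH G' D
| STL_Id A : STL_NH [A] (Some A)
| STL_LBot : STL_NH [⊥] None
| STL_RTop : STL_NH [] (Some ⊤)
| STL_Lw G A D : STL_NH G D -> STL_NH (A :: G) D
| STL_Rw G A : STL_NH G None -> STL_NH G (Some A)
| STL_Lc G A D : STL_NH (A :: A :: G) D -> STL_NH (A :: G) D
| STL_cut G S A D :
    STL_NH G (Some A) -> STL_NH (A :: S) D -> STL_NH (S ++ G) D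
| STL_LAnd1 G A B D : STL_NH (A :: G) D -> STL_NH (A ∧ B :: G) D
| STL_LAnd2 G A B D : STL_NH (B :: G) D -> STL_NH (A ∧ B :: G) D
| STL_RAnd G A B :
    STL_NH G (Some A) -> STL_NH G (Some B) -> STL_NH G (Some (A ∧ B))
| STL_LOr G A B D :
    STL_NH (A :: G) D -> STL_NH (B :: G) D -> STL_NH (A ∨ B :: G) D
| STL_ROr1 G A B : STL_NH G (Some A) -> STL_NH G (Some (A ∨ B))
| STL_ROr2 G A B : STL_NH G (Some B) -> STL_NH G (Some (A ∨ B))
| STL_N G D : STL_NH G D -> STL_NH (nabla_ctx G) (nabla_succ D)
| STL_LArr G A B D :
    STL_NH G (Some A) -> STL_NH (B :: G) D -> STL_NH (∇ (A → B) :: G) D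
| STL_RArr G A B :
    STL_NH (A :: nabla_ctx G) (Some B) -> STL_NH G (Some (A → B))
| STL_LImp G A B D :
    STL_NH G (Some A) -> STL_NH (B :: G) D -> STL_NH (A ⊃ B :: G) D
| STL_RImp G A B : STL_NH (A :: G) (Some B) -> STL_NH G (Some (A ⊃ B)).

Definition iKd_logic {V : Type} (A : formula V) : Prop := STL_NH [] (Some A).

(* Main.v *)
Require Import Defs.
From Stdlib Require Import List.
Import ListNotations.
From Stdlib Require Import Permutation PeanoNat Setoid.

Set Implicit Arguments.

Local Open Scope formula_scope.

(** Why the theorem is true.

    The first half is Maehara's method: an interpolant is read off a cut-free
    derivation of [G1, G2 => D] by recursion on it, for every splitting of the
    antecedent.  The logical rules behave as in intuitionistic logic; rule (N)
    turns an interpolant [C] into [∇ C], and rule (R→) turns it into [⊤ → C],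
    because [⊤ → _] is right adjoint to [∇].

    For the second half, [STL_NH] has cut, so a cut-free calculus complete for
    it is needed.  It is enough to have completeness for iK_d extended by
    contraction: contraction is harmless in Maehara's method, as both copies of
    the contracted formula go to the same side.  The family [iKd_with c]
    contains contraction exactly when [c] holds, so that [interpolation] covers
    both calculi at once.

    Completeness ([cut_elimination]) is proved semantically, in the style of
    Okada.  Sets of contexts that are intersections of sets
    [{G | ∇^n G, S => D is derivable without cut}] form a Heyting algebra, on
    which [∇] is given by the closure of direct images.  Each formula [A] is
    interpreted by such a set [sem A], containing the context [[A]] and
    consisting of contexts that derive [A] ([sem_self_derives]).  Since the
    algebra is sound for [STL_NH] ([sem_sound]), a provable [A → B] puts [[A]]
    into [sem B], whence [A => B] has a cut-free derivation.  The index [n] in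
    the generators makes the closed sets stable under inverse images of [∇],
    which is needed for [→]; in return it demands exactly the left rules under
    [∇^n] of the calculus.  Finally cut-free derivations translate back into
    [STL_NH] ([iKd_with_STL]). *)

(** * Permutations *)

(** Solves [Permutation l l'] when both sides are built from the same blocks:
    blocks on the right are rotated until the head block agrees with the one on
    the left, which is then cancelled. *)
Ltac perm :=
  solve [repeat match goal with
  | |- context [?x :: ?l] =>
      lazymatch l with
      | nil => fail
      | _ => change (x :: l) with ([x] ++ l)
      end
  end;
  rewrite <- ?app_assoc, ?app_nil_r, ?app_nil_l;
  do 30 try match goal with
  | |- Permutation ?a ?a => apply Permutation_refl
  | |- Permutation (?a ++ _) (?a ++ _) => apply Permutation_app_head
  | |- Permutation _ (?b ++ ?c) =>
      apply (Permutation_trans (l' := c ++ b));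
      [rewrite <- ?app_assoc | apply Permutation_app_comm]
  end].

Lemma cons_perm_app_inv (T : Type) (x : T) G G1 G2 :
  Permutation (x :: G) (G1 ++ G2) ->
  (exists H1, Permutation (x :: H1) G1 /\ Permutation G (H1 ++ G2)) \/
  (exists H2, Permutation (x :: H2) G2 /\ Permutation G (G1 ++ H2)).
Proof.
  intros HP.
  assert (Hx : In x (G1 ++ G2)) by (apply (Permutation_in _ HP); now left).
  apply in_app_or in Hx as [Hx | Hx]; apply in_split in Hx as (l & r & ->).
  - left; exists (l ++ r); split; [perm |].
    apply (Permutation_cons_inv (a := x)).
    apply (Permutation_trans HP); perm.
  - right; exists (l ++ r); split; [perm |].
    apply (Permutation_cons_inv (a := x)).
    apply (Permutation_trans HP); perm.
Qed.

Lemma app_perm_app_inv (T : Type) (S G G1 G2 : list T) :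
  Permutation (G ++ S) (G1 ++ G2) ->
  exists H1 H2 S1 S2,
    Permutation (H1 ++ S1) G1 /\ Permutation (H2 ++ S2) G2 /\
    Permutation G (H1 ++ H2).
Proof.
  revert G1 G2; induction G as [| x G IH]; intros G1 G2 HP.
  - exists [], [], G1, G2; simpl; auto.
  - apply cons_perm_app_inv in HP as [(K & HK & HP) | (K & HK & HP)];
      apply IH in HP as (H1 & H2 & S1 & S2 & P1 & P2 & P).
    + exists (x :: H1), H2, S1, S2; simpl; repeat split; auto.
      apply (Permutation_trans (perm_skip x P1)), HK.
    + exists H1, (x :: H2), S1, S2; simpl; repeat split; auto.
      * apply (Permutation_trans (perm_skip x P2)), HK.
      * apply (Permutation_trans (perm_skip x P)); perm.
Qed.

(** * Occurrences of atoms *)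

Section Occurrences.
Context {V : Type}.
Implicit Types (p : V) (A : formula V) (G : ctx V).

Lemma occurs_iter n p A : occurs p (∇^n A) <-> occurs p A.
Proof. induction n; simpl; tauto. Qed.

Lemma occurs_ctx_nil p : occurs_ctx p [] <-> False.
Proof. split; [intros (A & [] & _) | tauto]. Qed.

Lemma occurs_ctx_cons p A G :
  occurs_ctx p (A :: G) <-> occurs p A \/ occurs_ctx p G.
Proof.
  unfold occurs_ctx; simpl; split.
  - intros (B & [-> | HB] & Hp); eauto.
  - intros [Hp | (B & HB & Hp)]; eauto.
Qed.

Lemma occurs_ctx_app p G1 G2 :
  occurs_ctx p (G1 ++ G2) <-> occurs_ctx p G1 \/ occurs_ctx p G2.
Proof.
  induction G1 as [| A G1 IH]; simpl.
  - rewrite occurs_ctx_nil; tauto.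
  - rewrite !occurs_ctx_cons, IH; tauto.
Qed.

Lemma occurs_ctx_nabla p G : occurs_ctx p (nabla_ctx G) <-> occurs_ctx p G.
Proof.
  induction G as [| A G IH]; simpl.
  - tauto.
  - rewrite !occurs_ctx_cons, IH; simpl; tauto.
Qed.

Lemma occurs_nabla_succ p (D : succedent V) :
  occurs_ctx p (ctx_of_succ (nabla_succ D)) <-> occurs_ctx p (ctx_of_succ D).
Proof. destruct D as [A |]; [exact (occurs_ctx_nabla p [A]) | reflexivity]. Qed.

Lemma occurs_ctx_perm p G G' :
  Permutation G G' -> occurs_ctx p G -> occurs_ctx p G'.
Proof.
  intros HP (A & HA & Hp); exists A; split; [| exact Hp].
  now apply (Permutation_in _ HP).
Qed.

End Occurrences.

Ltac solve_occurs :=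
  simpl in *;
  rewrite ?occurs_ctx_cons, ?occurs_ctx_app, ?occurs_ctx_nabla,
    ?occurs_nabla_succ, ?occurs_ctx_nil, ?occurs_iter in *;
  simpl in *; rewrite ?occurs_iter in *; simpl in *; tauto.

(** * The cut-free calculi *)

(** The condition [c] switches contraction on, so that one interpolation proof
    serves the contraction-free calculus ([c := False]) and the one for which
    semantic cut elimination is carried out ([c := True]). *)
Inductive iKd_with {V : Type} (c : Prop) : ctx V -> succedent V -> Prop :=
| with_exchange G G' D : Permutation G G' -> iKd_with c G D -> iKd_with c G' D
| with_Lc G A D : c -> iKd_with c (A :: A :: G) D -> iKd_with c (A :: G) D
| with_Id p : iKd_with c [Atom p] (Some (Atom p))
| with_LBot : iKd_with c [⊥] None
| with_RTop : iKd_with c [] (Some ⊤)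
| with_LW G S D : iKd_with c G D -> iKd_with c (G ++ S) D
| with_Rw G A : iKd_with c G None -> iKd_with c G (Some A)
| with_LAnd n G A B D :
    iKd_with c (∇^n A :: ∇^n B :: G) D -> iKd_with c (∇^n (A ∧ B) :: G) D
| with_RAnd G A B :
    iKd_with c G (Some A) -> iKd_with c G (Some B) ->
    iKd_with c G (Some (A ∧ B))
| with_LOr n G A B D :
    iKd_with c (∇^n A :: G) D -> iKd_with c (∇^n B :: G) D ->
    iKd_with c (∇^n (A ∨ B) :: G) D
| with_ROr1 G A B : iKd_with c G (Some A) -> iKd_with c G (Some (A ∨ B))
| with_ROr2 G A B : iKd_with c G (Some B) -> iKd_with c G (Some (A ∨ B))
| with_LArr n G A B D :
    iKd_with c (∇^(S n) (A → B) :: G) (Some (∇^n A)) ->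
    iKd_with c (∇^n B :: ∇^(S n) (A → B) :: G) D ->
    iKd_with c (∇^(S n) (A → B) :: G) D
| with_RArr G A B :
    iKd_with c (A :: nabla_ctx G) (Some B) -> iKd_with c G (Some (A → B))
| with_LImp n G A B D :
    iKd_with c (∇^n (A ⊃ B) :: G) (Some (∇^n A)) ->
    iKd_with c (∇^n B :: G) D ->
    iKd_with c (∇^n (A ⊃ B) :: G) D
| with_RImp G A B :
    iKd_with c (A :: G) (Some B) -> iKd_with c G (Some (A ⊃ B))
| with_N G D : iKd_with c G D -> iKd_with c (nabla_ctx G) (nabla_succ D).

Lemma iKd_iff_without_contraction (V : Type) (G : ctx V) D :
  iKd G D <-> iKd_with False G D.
Proof.
  split; intros H.
  - induction H;
      [ eapply with_exchange; eassumption
      | now apply with_Id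
      | now apply with_LBot
      | now apply with_RTop
      | now apply with_LW
      | now apply with_Rw
      | now apply with_LAnd
      | now apply with_RAnd
      | now apply with_LOr
      | now apply with_ROr1
      | now apply with_ROr2
      | now apply with_LArr
      | now apply with_RArr
      | now apply with_LImp
      | now apply with_RImp
      | now apply with_N ].
  - induction H;
      [ eapply iKd_exchange; eassumption
      | contradiction
      | now apply iKd_Id
      | now apply iKd_LBot
      | now apply iKd_RTop
      | now apply iKd_LW
      | now apply iKd_Rw
      | now apply iKd_LAnd
      | now apply iKd_RAnd
      | now apply iKd_LOr
      | now apply iKd_ROr1
      | now apply iKd_ROr2
      | now apply iKd_LArr
      | now apply iKd_RArr
      | now apply iKd_LImp
      | now apply iKd_RImp
      | now apply iKd_N ].
Qed.

Section Derived_rules.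
Context {V : Type} (c : Prop).
Implicit Types (A B C : formula V) (G S : ctx V) (D : succedent V).

Lemma iKd_with_weaken G S G' D :
  iKd_with c G D -> Permutation (G ++ S) G' -> iKd_with c G' D.
Proof. intros H HP; apply (with_exchange HP), with_LW, H. Qed.

Lemma iKd_with_Rw_any G D : iKd_with c G None -> iKd_with c G D.
Proof. intros H; destruct D; [now apply with_Rw | exact H]. Qed.

Lemma iKd_with_LAnd0 G A B D :
  iKd_with c (A :: B :: G) D -> iKd_with c (A ∧ B :: G) D.
Proof. exact (@with_LAnd V c 0 G A B D). Qed.

Lemma iKd_with_LArr0 G A B D :
  iKd_with c (∇ (A → B) :: G) (Some A) ->
  iKd_with c (B :: ∇ (A → B) :: G) D ->
  iKd_with c (∇ (A → B) :: G) D.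
Proof. exact (@with_LArr V c 0 G A B D). Qed.

Lemma iKd_with_LImp0 G A B D :
  iKd_with c (A ⊃ B :: G) (Some A) -> iKd_with c (B :: G) D ->
  iKd_with c (A ⊃ B :: G) D.
Proof. exact (@with_LImp V c 0 G A B D). Qed.

End Derived_rules.

Ltac reorder L := apply (with_exchange (G := L)); [perm |].

Ltac weaken H S :=
  apply (iKd_with_weaken S H); simpl in *; perm.

(** * Interpolation *)

Section Interpolation.
Context {V : Type} (c : Prop).
Implicit Types (A B C : formula V) (G S : ctx V) (D : succedent V).

Definition interpolant C G1 G2 D : Prop :=
  iKd_with c G1 (Some C) /\
  iKd_with c (C :: G2) D /\
  forall p, occurs p C ->
    occurs_ctx p G1 /\ (occurs_ctx p G2 \/ occurs_ctx p (ctx_of_succ D)).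

Definition interpolable G1 G2 D : Prop := exists C, interpolant C G1 G2 D.

Lemma interpolable_perm G1 G2 G1' G2' D :
  Permutation G1 G1' -> Permutation G2 G2' ->
  interpolable G1 G2 D -> interpolable G1' G2' D.
Proof.
  intros P1 P2 (C & H1 & H2 & HC); exists C; repeat split.
  - apply (with_exchange P1 H1).
  - apply (with_exchange (perm_skip C P2) H2).
  - apply (occurs_ctx_perm P1), HC, H.
  - destruct (HC p H) as [_ [Hp | Hp]]; [left | now right].
    now apply (occurs_ctx_perm P2).
Qed.

End Interpolation.

Ltac occurs_cond :=
  let p := fresh "p" in
  intros p;
  repeat match goal with
  | H : forall q : _, occurs q _ -> _ |- _ => specialize (H p)
  end;
  solve_occurs.

Ltac interpolate C := exists C; split; [| split; [| occurs_cond]].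

Tactic Notation "left_rule" hyp(HP) "on" constr(G1) constr(G2) :=
  apply cons_perm_app_inv in HP as [(K & HK & HP) | (K & HK & HP)];
  [apply (interpolable_perm HK (Permutation_refl G2))
  |apply (interpolable_perm (Permutation_refl G1) HK)].

(** Rules with two premises combine the interpolants: by conjunction when a left
    rule acts in [G2] or a right rule is used, by
    disjunction for [∨] in [G1], and by [⊃] when an implication is principal in
    [G1].  In the last case the left premise has the roles of [G1] and [G2]
    exchanged, so that its interpolant [C1] comes out on the side of [G2] and
    [C1 ⊃ C2] is passed from [G1] to [G2]. *)
Lemma interpolation (V : Type) (c : Prop) (G : ctx V) D :
  iKd_with c G D ->
  forall G1 G2, Permutation G (G1 ++ G2) -> interpolable c G1 G2 D.
Proof.
  intros H; induction H as
    [ G G' D P _ IH | G A D Hc _ IH | p | | | G S D H IH | G A _ IH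
    | n G A B D _ IH | G A B _ IHA _ IHB | n G A B D _ IHA _ IHB
    | G A B _ IH | G A B _ IH | n G A B D _ IHA _ IHB | G A B _ IH
    | n G A B D _ IHA _ IHB | G A B _ IH | G D _ IH ]; intros G1 G2 HP.
  - apply IH, (Permutation_trans P HP).
  - left_rule HP on G1 G2.
    + destruct (IH (A :: A :: K) G2) as (C & H1 & H2 & HC).
      { apply (Permutation_app_head [A; A] HP). }
      interpolate C; [now apply with_Lc | exact H2].
    + destruct (IH G1 (A :: A :: K)) as (C & H1 & H2 & HC).
      { apply (Permutation_trans (Permutation_app_head [A; A] HP)); perm. }
      interpolate C; [exact H1 |].
      reorder (A :: C :: K); apply with_Lc; [assumption |].
      reorder (C :: A :: A :: K); exact H2.
  - left_rule HP on G1 G2; apply Permutation_nil, app_eq_nil in HP as [-> ->].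
    + interpolate (Atom p); apply with_Id.
    + interpolate (⊤ : formula V); [apply with_RTop |].
      weaken (with_Id c p) [⊤ : formula V].
  - left_rule HP on G1 G2; apply Permutation_nil, app_eq_nil in HP as [-> ->].
    + interpolate (⊥ : formula V); [apply with_Rw |]; apply with_LBot.
    + interpolate (⊤ : formula V); [apply with_RTop |].
      weaken (@with_LBot V c) [⊤ : formula V].
  - apply Permutation_nil, app_eq_nil in HP as [-> ->].
    interpolate (⊤ : formula V); [apply with_RTop |].
    weaken (@with_RTop V c) [⊤ : formula V].
  - apply app_perm_app_inv in HP as (K1 & K2 & S1 & S2 & P1 & P2 & P).
    destruct (IH _ _ P) as (C & H1 & H2 & HC).
    apply (interpolable_perm P1 P2).
    interpolate C; [weaken H1 S1 | weaken H2 S2].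
  - destruct (IH _ _ HP) as (C & H1 & H2 & HC).
    interpolate C; [exact H1 | now apply with_Rw].
  - left_rule HP on G1 G2.
    + destruct (IH (∇^n A :: ∇^n B :: K) G2) as (C & H1 & H2 & HC).
      { apply (Permutation_app_head [_; _] HP). }
      interpolate C; [now apply with_LAnd | exact H2].
    + destruct (IH G1 (∇^n A :: ∇^n B :: K)) as (C & H1 & H2 & HC).
      { apply (Permutation_trans (Permutation_app_head [_; _] HP)); perm. }
      interpolate C; [exact H1 |].
      reorder (∇^n (A ∧ B) :: C :: K); apply with_LAnd.
      reorder (C :: ∇^n A :: ∇^n B :: K); exact H2.
  - destruct (IHA _ _ HP) as (C1 & H1 & H1' & HC1).
    destruct (IHB _ _ HP) as (C2 & H2 & H2' & HC2).
    interpolate (C1 ∧ C2); [now apply with_RAnd |].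
    apply iKd_with_LAnd0, with_RAnd; [weaken H1' [C2] | weaken H2' [C1]].
  - left_rule HP on G1 G2.
    + destruct (IHA (∇^n A :: K) G2) as (C1 & H1 & H1' & HC1).
      { apply (perm_skip _ HP). }
      destruct (IHB (∇^n B :: K) G2) as (C2 & H2 & H2' & HC2).
      { apply (perm_skip _ HP). }
      interpolate (C1 ∨ C2).
      * apply with_LOr; [now apply with_ROr1 | now apply with_ROr2].
      * now apply (with_LOr 0 C1 C2).
    + destruct (IHA G1 (∇^n A :: K)) as (C1 & H1 & H1' & HC1).
      { apply (Permutation_trans (perm_skip _ HP)); perm. }
      destruct (IHB G1 (∇^n B :: K)) as (C2 & H2 & H2' & HC2).
      { apply (Permutation_trans (perm_skip _ HP)); perm. }
      interpolate (C1 ∧ C2); [now apply with_RAnd |].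
      apply iKd_with_LAnd0.
      reorder (∇^n (A ∨ B) :: C1 :: C2 :: K).
      apply with_LOr; [weaken H1' [C2] | weaken H2' [C1]].
  - destruct (IH _ _ HP) as (C & H1 & H2 & HC).
    interpolate C; [exact H1 | now apply with_ROr1].
  - destruct (IH _ _ HP) as (C & H1 & H2 & HC).
    interpolate C; [exact H1 | now apply with_ROr2].
  - left_rule HP on G1 G2.
    + destruct (IHA G2 (∇^(S n) (A → B) :: K)) as (C1 & H1 & H1' & HC1).
      { apply (Permutation_trans (perm_skip _ HP)); perm. }
      destruct (IHB (∇^n B :: ∇^(S n) (A → B) :: K) G2) as (C2 & H2 & H2' & HC2).
      { apply (Permutation_app_head [_; _] HP). }
      interpolate (C1 ⊃ C2).
      * apply with_RImp; reorder (∇^(S n) (A → B) :: C1 :: K); apply with_LArr.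
        -- weaken H1' (@nil (formula V)).
        -- weaken H2 [C1].
      * apply iKd_with_LImp0; [weaken H1 [C1 ⊃ C2] | exact H2'].
    + destruct (IHA G1 (∇^(S n) (A → B) :: K)) as (C1 & H1 & H1' & HC1).
      { apply (Permutation_trans (perm_skip _ HP)); perm. }
      destruct (IHB G1 (∇^n B :: ∇^(S n) (A → B) :: K)) as (C2 & H2 & H2' & HC2).
      { apply (Permutation_trans (Permutation_app_head [_; _] HP)); perm. }
      interpolate (C1 ∧ C2); [now apply with_RAnd |].
      apply iKd_with_LAnd0.
      reorder (∇^(S n) (A → B) :: C1 :: C2 :: K); apply with_LArr.
      * weaken H1' [C2].
      * weaken H2' [C1].
  - (* Both sides move under [∇] in the premise; [⊤ → C] carries the interpolant
       [C] back, because [∇ (⊤ → C)] yields [C] on the right. *)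
    destruct (IH (nabla_ctx G1) (A :: nabla_ctx G2)) as (C & H1 & H2 & HC).
    { apply (Permutation_map (@Nabla V)) in HP; unfold nabla_ctx.
      rewrite map_app in HP.
      apply (Permutation_trans (perm_skip A HP)); perm. }
    interpolate (⊤ → C).
    + apply with_RArr; weaken H1 [⊤ : formula V].
    + apply with_RArr; simpl.
      reorder (∇ (⊤ → C) :: A :: nabla_ctx G2).
      apply iKd_with_LArr0.
      * weaken (@with_RTop V c) (∇ (⊤ → C) :: A :: nabla_ctx G2).
      * weaken H2 [∇ (⊤ → C)].
  - left_rule HP on G1 G2.
    + destruct (IHA G2 (∇^n (A ⊃ B) :: K)) as (C1 & H1 & H1' & HC1).
      { apply (Permutation_trans (perm_skip _ HP)); perm. }
      destruct (IHB (∇^n B :: K) G2) as (C2 & H2 & H2' & HC2).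
      { apply (perm_skip _ HP). }
      interpolate (C1 ⊃ C2).
      * apply with_RImp; reorder (∇^n (A ⊃ B) :: C1 :: K); apply with_LImp.
        -- weaken H1' (@nil (formula V)).
        -- weaken H2 [C1].
      * apply iKd_with_LImp0; [weaken H1 [C1 ⊃ C2] | exact H2'].
    + destruct (IHA G1 (∇^n (A ⊃ B) :: K)) as (C1 & H1 & H1' & HC1).
      { apply (Permutation_trans (perm_skip _ HP)); perm. }
      destruct (IHB G1 (∇^n B :: K)) as (C2 & H2 & H2' & HC2).
      { apply (Permutation_trans (perm_skip _ HP)); perm. }
      interpolate (C1 ∧ C2); [now apply with_RAnd |].
      apply iKd_with_LAnd0.
      reorder (∇^n (A ⊃ B) :: C1 :: C2 :: K).
      apply with_LImp; [weaken H1' [C2] | weaken H2' [C1]].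
  - destruct (IH G1 (A :: G2)) as (C & H1 & H2 & HC).
    { apply (Permutation_trans (perm_skip _ HP)); perm. }
    interpolate C; [exact H1 |].
    apply with_RImp; weaken H2 (@nil (formula V)).
  - apply Permutation_sym, Permutation_map_inv in HP as (K & HK & HP).
    symmetry in HK; apply map_eq_app in HK as (K1 & K2 & -> & <- & <-).
    destruct (IH _ _ HP) as (C & H1 & H2 & HC).
    change (interpolable c (nabla_ctx K1) (nabla_ctx K2) (nabla_succ D)).
    interpolate (∇ C); [exact (with_N H1) | exact (with_N H2)].
Qed.

(** * Cut elimination *)

Section Semantics.
Context {V : Type}.
Implicit Types (A B C : formula V) (G S T : ctx V) (D : succedent V)
  (X Y Z : ctx V -> Prop).

Local Notation derives := (@iKd_with V True).

Definition nablas n G : ctx V := map (fun A => ∇^n A) G.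

Lemma nablas_0 G : nablas 0 G = G.
Proof. apply map_id. Qed.

Lemma nablas_app n G S : nablas n (G ++ S) = nablas n G ++ nablas n S.
Proof. apply map_app. Qed.

Lemma nablas_nabla n G : nablas n (nabla_ctx G) = nablas (S n) G.
Proof.
  unfold nablas, nabla_ctx; rewrite map_map; apply map_ext; intros A.
  apply Nat.iter_swap.
Qed.

Lemma derives_N_iter n G D :
  derives G D -> derives (nablas n G) (option_map (fun A => ∇^n A) D).
Proof.
  intros H; induction n as [| n IH].
  - rewrite nablas_0; destruct D; exact H.
  - apply with_N in IH; unfold nablas, nabla_ctx in *.
    rewrite map_map in IH; destruct D; exact IH.
Qed.

Lemma derives_contract G S D : derives (G ++ G ++ S) D -> derives (G ++ S) D.
Proof.
  revert S; induction G as [| A G IH]; intros S H; [exact H |].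
  reorder (G ++ A :: S); apply IH; reorder (A :: G ++ G ++ S).
  apply with_Lc; [exact I |].
  reorder ((A :: G) ++ (A :: G) ++ S); exact H.
Qed.

(** The least intersection of sets [{G | ∇^n G, S => D}] that contains [X].
    Quantifying over [n], not only over [S] and [D], makes inverse images of
    closed sets under [∇] closed again. *)
Definition closure X : ctx V -> Prop := fun G =>
  forall n S D,
    (forall G', X G' -> derives (nablas n G' ++ S) D) ->
    derives (nablas n G ++ S) D.

Definition closed X : Prop := forall G, closure X G -> X G.

Lemma closure_closed X : closed (closure X).
Proof. intros G HG n S D H; apply HG; intros G' HG'; exact (HG' n S D H). Qed.

Lemma closure_incl X G : X G -> closure X G.
Proof. intros HX n S D H; exact (H G HX). Qed.

(** The closure operator is a nucleus: elements of a closure may be replaced by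
    generators in any side context [S].  Together with contraction, this gives
    the distributivity of meets over joins and of [∇] over finite meets. *)
Lemma closure_elim X Z G S :
  closed Z -> closure X G -> (forall G', X G' -> Z (G' ++ S)) -> Z (G ++ S).
Proof.
  intros HZ HG H; apply HZ; intros n T D HD.
  rewrite nablas_app, <- app_assoc; apply HG; intros G' HG'.
  rewrite app_assoc, <- nablas_app; apply HD, H, HG'.
Qed.

Lemma closed_perm Z G G' : closed Z -> Permutation G G' -> Z G -> Z G'.
Proof.
  intros HZ HP HG; apply HZ; intros n S D H.
  apply (with_exchange (G := nablas n G ++ S)); [| exact (H G HG)].
  apply Permutation_app_tail, Permutation_map, HP.
Qed.

Lemma closed_weaken Z G S : closed Z -> Z G -> Z (G ++ S).
Proof.
  intros HZ HG; apply HZ; intros n T D H.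
  rewrite nablas_app; weaken (H G HG) (nablas n S).
Qed.

Lemma closed_weaken_l Z G S : closed Z -> Z G -> Z (S ++ G).
Proof.
  intros HZ HG; apply (closed_perm HZ (Permutation_app_comm G S)).
  now apply closed_weaken.
Qed.

Lemma closed_contract Z G S : closed Z -> Z (G ++ G ++ S) -> Z (G ++ S).
Proof.
  intros HZ HG; apply HZ; intros n T D H.
  apply H in HG; rewrite !nablas_app, <- !app_assoc in *.
  now apply derives_contract.
Qed.

Lemma closed_contract_all Z G : closed Z -> Z (G ++ G) -> Z G.
Proof.
  intros HZ HG; rewrite <- (app_nil_r G); apply closed_contract; [exact HZ |].
  now rewrite app_nil_r.
Qed.

(** Meets are intersections.  Closed sets admit weakening and contraction, so
    adding a context [S] from [sem B] to [G] amounts to meeting [sem B]; hence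
    the clauses for [⊃] and [→] are the right adjoints of meeting [sem B], and
    of [∇] followed by it. *)
Fixpoint sem A : ctx V -> Prop :=
  match A with
  | Atom p => fun G => derives G (Some (Atom p))
  | Top => fun _ => True
  | Bot => closure (fun _ => False)
  | And B C => fun G => sem B G /\ sem C G
  | Or B C => closure (fun G => sem B G \/ sem C G)
  | Imp B C => fun G => forall S, sem B S -> sem C (G ++ S)
  | Arr B C => fun G => forall S, sem B S -> sem C (nabla_ctx G ++ S)
  | Nabla B => closure (fun G => exists S, G = nabla_ctx S /\ sem B S)
  end.

Definition sem_succ D : ctx V -> Prop :=
  match D with Some A => sem A | None => sem ⊥ end.

Definition sem_ctx G : ctx V -> Prop :=
  fun S => forall A, In A G -> sem A S.

Lemma sem_closed A : closed (sem A).
Proof.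
  induction A as [p | | | B HB C HC | B HB C HC | B HB C HC | B HB C HC | B HB];
    simpl; try apply closure_closed.
  - intros G HG; specialize (HG 0 [] (Some (Atom p))).
    rewrite nablas_0, app_nil_r in HG; apply HG; intros G' H.
    now rewrite nablas_0, app_nil_r.
  - now intros G _.
  - intros G HG; split; [apply HB | apply HC]; intros n S D H;
      apply HG; intros G' [H1 H2]; now apply H.
  - intros G HG S HS; apply (closure_elim _ HC HG); intros G' HG'; now apply HG'.
  - intros G HG S HS; apply HC; intros n T D H.
    rewrite nablas_app, nablas_nabla, <- app_assoc; apply HG; intros G' HG'.
    rewrite app_assoc, <- nablas_nabla, <- nablas_app; now apply H, HG'.
Qed.

Lemma sem_succ_closed D : closed (sem_succ D).
Proof. destruct D as [A |]; apply sem_closed. Qed.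

(** Okada's lemma: the left rules give the first half, the right rules the
    second. *)
Lemma sem_self_derives A :
  sem A [A] /\ (forall G, sem A G -> derives G (Some A)).
Proof.
  induction A as [p | | | B [B1 B2] C [C1 C2] | B [B1 B2] C [C1 C2]
    | B [B1 B2] C [C1 C2] | B [B1 B2] C [C1 C2] | B [B1 B2]]; split; simpl.
  - apply with_Id.
  - auto.
  - exact I.
  - intros G _; exact (with_LW G (@with_RTop V True)).
  - intros n S D _.
    apply with_LW, iKd_with_Rw_any, (derives_N_iter n (@with_LBot V True)).
  - intros G HG; specialize (HG 0 [] (Some ⊥)).
    rewrite nablas_0, app_nil_r in HG; now apply HG.
  - split; apply sem_closed; intros n S D H; apply with_LAnd.
    + specialize (H _ B1); weaken H [∇^n C].
    + specialize (H _ C1); weaken H [∇^n B].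
  - intros G [H1 H2]; now apply with_RAnd; auto.
  - intros n S D H; apply with_LOr.
    + apply (H [B]); now left.
    + apply (H [C]); now right.
  - intros G HG; specialize (HG 0 [] (Some (B ∨ C))).
    rewrite nablas_0, app_nil_r in HG; apply HG; intros G' H.
    rewrite nablas_0, app_nil_r.
    destruct H; [apply with_ROr1 | apply with_ROr2]; auto.
  - intros S HS; apply sem_closed; intros n T D H; simpl.
    apply with_LImp.
    + apply B2, (derives_N_iter n) in HS; simpl in HS.
      weaken HS (∇^n (B ⊃ C) :: T).
    + specialize (H _ C1); weaken H (nablas n S).
  - intros G HG; apply with_RImp.
    reorder (G ++ [B]); apply C2, HG, B1.
  - intros G HG; apply sem_closed; intros n T D H; simpl.
    rewrite Nat.iter_swap; apply (@with_LArr _ _ n _ B C).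
    + apply B2, (derives_N_iter n) in HG; simpl in HG.
      weaken HG (∇^(S n) (B → C) :: T).
    + specialize (H _ C1); weaken H (∇^(S n) (B → C) :: nablas n G).
  - intros G HG; apply with_RArr.
    reorder (nabla_ctx G ++ [B]); apply C2, HG, B1.
  - apply closure_incl; exists [B]; auto.
  - intros G HG; specialize (HG 0 [] (Some (∇ B))).
    rewrite nablas_0, app_nil_r in HG; apply HG; intros G' (S & -> & HS).
    rewrite nablas_0, app_nil_r; exact (with_N (B2 S HS)).
Qed.

Lemma sem_ctx_cons A G S : sem_ctx (A :: G) S <-> sem A S /\ sem_ctx G S.
Proof.
  unfold sem_ctx; simpl; split.
  - auto.
  - intros [HA HG] B [<- | HB]; auto.
Qed.

Lemma sem_ctx_weaken G S T : sem_ctx G S -> sem_ctx G (S ++ T).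
Proof. intros H A HA; apply closed_weaken; [apply sem_closed | auto]. Qed.

Lemma sem_ctx_weaken_l G S T : sem_ctx G S -> sem_ctx G (T ++ S).
Proof.
  intros H A HA; apply closed_weaken_l; [apply sem_closed | auto].
Qed.

Lemma sem_nabla_ctx G S : sem_ctx G S -> sem_ctx (nabla_ctx G) (nabla_ctx S).
Proof.
  intros H A HA; apply in_map_iff in HA as (B & <- & HB).
  apply closure_incl; exists S; split; [reflexivity | exact (H B HB)].
Qed.

(** [∇] preserves finite meets: a context [G0] in every [sem (∇ B)], for [B] in
    [G], lies in each closed set that contains [∇ G'] for all [G'] in [sem_ctx G].
    The members of [G] are treated one after the other, each using up one copy
    of [G0], and the copies are contracted. *)
Lemma sem_nabla_ctx_elim Z G G0 S :
  closed Z -> sem_ctx (nabla_ctx G) G0 ->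
  (forall G', sem_ctx G G' -> Z (nabla_ctx G' ++ S)) -> Z (G0 ++ S).
Proof.
  intros HZ; revert S; induction G as [| B G IH]; intros S HG H.
  - apply (closed_weaken_l _ _ HZ), (H []); intros A [].
  - apply sem_ctx_cons in HG as [HB HG].
    apply (closed_contract _ _ HZ), (closure_elim _ HZ HB).
    intros G1' (G1 & -> & H1).
    apply (closed_perm HZ (G := G0 ++ nabla_ctx G1 ++ S)); [perm |].
    apply IH; [exact HG |]; intros G' HG'.
    rewrite app_assoc; unfold nabla_ctx; rewrite <- map_app.
    apply H, sem_ctx_cons; split.
    + apply closed_weaken_l; [apply sem_closed | exact H1].
    + now apply sem_ctx_weaken.
Qed.

(** The rules hold in the algebra of closed sets; cut is composition of
    inclusions. *)
Lemma sem_sound G D : STL_NH G D -> forall S, sem_ctx G S -> sem_succ D S.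
Proof.
  intros H; induction H as
    [ G G' D P _ IH | A | | | G A D _ IH | G A _ IH | G A D _ IH
    | G T A D _ IHA _ IH | G A B D _ IH | G A B D _ IH | G A B _ IHA _ IHB
    | G A B D _ IHA _ IHB | G A B _ IH | G A B _ IH | G D _ IH
    | G A B D _ IHA _ IHB | G A B _ IH | G A B D _ IHA _ IHB | G A B _ IH ];
    intros S HS.
  - apply IH; intros A HA; apply HS, (Permutation_in _ P HA).
  - apply HS; now left.
  - apply HS; now left.
  - exact I.
  - apply IH; apply sem_ctx_cons in HS; tauto.
  - apply sem_closed; intros n T D _; now apply (IH S HS).
  - apply IH; rewrite !sem_ctx_cons in *; tauto.
  - apply IH, sem_ctx_cons; split.
    + apply IHA; intros B HB; apply HS, in_or_app; now right.
    + intros B HB; apply HS, in_or_app; now left.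
  - apply IH; rewrite sem_ctx_cons in *; simpl in HS; tauto.
  - apply IH; rewrite sem_ctx_cons in *; simpl in HS; tauto.
  - split; [now apply IHA | now apply IHB].
  - apply sem_ctx_cons in HS as [HAB HS].
    apply (closed_contract_all _ (sem_succ_closed D)).
    apply (closure_elim _ (sem_succ_closed D) HAB); intros G' [HG' | HG'].
    + apply IHA, sem_ctx_cons; split; [| now apply sem_ctx_weaken_l].
      apply closed_weaken; [apply sem_closed | exact HG'].
    + apply IHB, sem_ctx_cons; split; [| now apply sem_ctx_weaken_l].
      apply closed_weaken; [apply sem_closed | exact HG'].
  - apply closure_incl; left; now apply IH.
  - apply closure_incl; right; now apply IH.
  - rewrite <- (app_nil_r S).
    apply (sem_nabla_ctx_elim _ (sem_succ_closed _) HS); intros G' HG'.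
    rewrite app_nil_r; apply IH in HG'; destruct D as [A |]; simpl in *.
    + apply closure_incl; eauto.
    + intros n T D _; rewrite nablas_nabla; now apply HG'.
  - apply sem_ctx_cons in HS as [HAB HS].
    apply IHB, sem_ctx_cons; split; [| exact HS].
    apply (closed_contract_all _ (sem_closed B)).
    apply (closure_elim _ (sem_closed B) HAB); intros G1' (G1 & -> & H1).
    now apply H1, IHA.
  - intros S' HS'; apply IH, sem_ctx_cons; split.
    + apply closed_weaken_l; [apply sem_closed | exact HS'].
    + now apply sem_ctx_weaken, sem_nabla_ctx.
  - apply sem_ctx_cons in HS as [HAB HS].
    apply IHB, sem_ctx_cons; split; [| exact HS].
    apply (closed_contract_all _ (sem_closed B)).
    now apply HAB, IHA.
  - intros S' HS'; apply IH, sem_ctx_cons; split.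
    + apply closed_weaken_l; [apply sem_closed | exact HS'].
    + now apply sem_ctx_weaken.
Qed.

(** [G] belongs to the interpretation of each of its members, hence to that of
    [D], and membership there means derivability without cut. *)
Lemma cut_elimination G D : STL_NH G D -> derives G D.
Proof.
  intros H.
  assert (HG : sem_ctx G G).
  { intros A HA; apply in_split in HA as (l & r & ->).
    apply (closed_perm (sem_closed A) (G := [A] ++ l ++ r)); [perm |].
    apply closed_weaken; [apply sem_closed | apply sem_self_derives]. }
  apply (sem_sound H) in HG; destruct D as [A |].
  - now apply sem_self_derives.
  - specialize (HG 0 [] None); rewrite nablas_0, app_nil_r in HG; now apply HG.
Qed.

End Semantics.

(** * Soundness of the cut-free calculi *)

Section Soundness.
Context {V : Type}.
Implicit Types (A B C : formula V) (G S : ctx V) (D : succedent V).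

Lemma STL_incl G S D : incl G S -> STL_NH G D -> STL_NH S D.
Proof.
  intros HGS H.
  assert (HS : STL_NH (G ++ S) D).
  { apply (STL_exchange (Permutation_app_comm S G)); clear HGS.
    induction S as [| A S IH]; [exact H | now apply STL_Lw]. }
  clear H; induction G as [| A G IH]; [exact HS |].
  apply IH; [intros B HB; apply HGS; now right |].
  assert (HA : In A (G ++ S)) by (apply in_or_app; right; apply HGS; now left).
  apply in_split in HA as (l & r & E); simpl in HS; rewrite E in *.
  apply (STL_exchange (G := A :: l ++ r)); [perm |]; apply STL_Lc.
  apply (STL_exchange (G := A :: l ++ A :: r)); [perm | exact HS].
Qed.

(** Cut in the form in which the left rules below use it: the cut formula
    follows from some formulas present in [G]. *)
Lemma STL_cut_incl S A G D :
  STL_NH S (Some A) -> incl S G -> STL_NH (A :: G) D -> STL_NH G D.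
Proof.
  intros HA HS H; apply (STL_incl (G := G ++ S)).
  - now apply incl_app; [apply incl_refl |].
  - exact (STL_cut HA H).
Qed.

Lemma STL_N_iter n G D :
  STL_NH G D ->
  STL_NH (map (fun A => ∇^n A) G) (option_map (fun A => ∇^n A) D).
Proof.
  intros H; induction n as [| n IH].
  - rewrite map_id; destruct D; exact H.
  - apply STL_N in IH; unfold nabla_ctx in IH; rewrite map_map in IH.
    destruct D; exact IH.
Qed.

Lemma STL_and_iter1 n A B : STL_NH [∇^n (A ∧ B)] (Some (∇^n A)).
Proof. apply (STL_N_iter n (G := [_]) (D := Some _)), STL_LAnd1, STL_Id. Qed.

Lemma STL_and_iter2 n A B : STL_NH [∇^n (A ∧ B)] (Some (∇^n B)).
Proof. apply (STL_N_iter n (G := [_]) (D := Some _)), STL_LAnd2, STL_Id. Qed.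

(** The unit and counit of the adjunction between [∇] and [⊤ → _] make [∇]
    distribute over disjunctions. *)
Lemma STL_nabla_or A B : STL_NH [∇ (A ∨ B)] (Some (∇ A ∨ ∇ B)).
Proof.
  apply (STL_cut_incl (S := [∇ (A ∨ B)]) (A := ∇ (⊤ → ∇ A ∨ ∇ B)));
    [| apply incl_refl |].
  - apply (STL_N (G := [A ∨ B]) (D := Some _)).
    apply STL_LOr; apply STL_RArr, STL_Lw.
    + apply STL_ROr1, STL_Id.
    + apply STL_ROr2, STL_Id.
  - apply STL_LArr.
    + apply STL_Lw, STL_RTop.
    + apply (STL_incl (G := [∇ A ∨ ∇ B])); [| apply STL_Id].
      intros C [<- | []]; now left.
Qed.

Lemma STL_or_iter n A B : STL_NH [∇^n (A ∨ B)] (Some (∇^n A ∨ ∇^n B)).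
Proof.
  induction n as [| n IH]; [apply STL_Id |].
  apply STL_N in IH; simpl in *.
  exact (STL_cut (S := []) IH (STL_nabla_or _ _)).
Qed.

Lemma STL_arr_iter n A B :
  STL_NH [∇^(S n) (A → B); ∇^n A] (Some (∇^n B)).
Proof.
  simpl; rewrite <- Nat.iter_swap.
  apply (STL_N_iter n (G := [_; _]) (D := Some _)), STL_LArr; [apply STL_Id |].
  apply (STL_incl (G := [B])); [intros C [<- | []]; now left | apply STL_Id].
Qed.

Lemma STL_imp_iter n A B : STL_NH [∇^n (A ⊃ B); ∇^n A] (Some (∇^n B)).
Proof.
  apply (STL_N_iter n (G := [_; _]) (D := Some _)), STL_LImp; [apply STL_Id |].
  apply (STL_incl (G := [B])); [intros C [<- | []]; now left | apply STL_Id].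
Qed.

Ltac solve_incl := intros ?; simpl; rewrite ?in_app_iff; tauto.

Lemma iKd_with_STL c G D : iKd_with c G D -> STL_NH G D.
Proof.
  intros H; induction H as
    [ G G' D P _ IH | G A D _ _ IH | p | | | G S D _ IH | G A _ IH
    | n G A B D _ IH | G A B _ IHA _ IHB | n G A B D _ IHA _ IHB
    | G A B _ IH | G A B _ IH | n G A B D _ IHA _ IHB | G A B _ IH
    | n G A B D _ IHA _ IHB | G A B _ IH | G D _ IH ].
  - exact (STL_exchange P IH).
  - exact (STL_Lc IH).
  - apply STL_Id.
  - apply STL_LBot.
  - apply STL_RTop.
  - apply (STL_incl (G := G)); [solve_incl | exact IH].
  - exact (STL_Rw A IH).
  - apply (STL_cut_incl (STL_and_iter1 n A B)); [solve_incl |].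
    apply (STL_cut_incl (STL_and_iter2 n A B)); [solve_incl |].
    apply (STL_incl (G := ∇^n A :: ∇^n B :: G)); [solve_incl | exact IH].
  - now apply STL_RAnd.
  - apply (STL_cut_incl (STL_or_iter n A B)); [solve_incl |].
    apply STL_LOr.
    + apply (STL_incl (G := ∇^n A :: G)); [solve_incl | exact IHA].
    + apply (STL_incl (G := ∇^n B :: G)); [solve_incl | exact IHB].
  - now apply STL_ROr1.
  - now apply STL_ROr2.
  - apply (STL_cut_incl IHA); [solve_incl |].
    apply (STL_cut_incl (STL_arr_iter n A B)); [solve_incl |].
    eapply STL_incl; [| exact IHB]; solve_incl.
  - now apply STL_RArr.
  - apply (STL_cut_incl IHA); [solve_incl |].
    apply (STL_cut_incl (STL_imp_iter n A B)); [solve_incl |].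
    apply (STL_incl (G := ∇^n B :: G)); [solve_incl | exact IHB].
  - now apply STL_RImp.
  - exact (STL_N IH).
Qed.

End Soundness.

(** * Craig interpolation *)

(** [R→] is invertible in the presence of cut, since [∇ (A → B), A => B]. *)
Lemma STL_RArr_inv (V : Type) (A B : formula V) :
  STL_NH [] (Some (A → B)) -> STL_NH [A] (Some B).
Proof.
  intros H.
  apply (STL_cut_incl (STL_N H)); [intros C [] |].
  apply STL_LArr; [apply STL_Id |].
  apply (STL_incl (G := [B])); [intros C [<- | []]; now left | apply STL_Id].
Qed.

Theorem theorem18 (V : Type) :
  (forall (G1 G2 : ctx V) (D : succedent V),
     iKd (G1 ++ G2) D ->
     exists C : formula V,
       iKd G1 (Some C) /\
       iKd (G2 ++ [C]) D /\
       (forall p : V, occurs p C ->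
          occurs_ctx p G1 /\ occurs_ctx p (G2 ++ ctx_of_succ D)))
  /\
  (forall A B : formula V,
     iKd_logic (Arr A B) ->
     exists C : formula V,
       iKd_logic (Arr A C) /\
       iKd_logic (Arr C B) /\
       (forall p : V, occurs p C -> occurs p A /\ occurs p B)).
Proof.
  split.
  - intros G1 G2 D H; apply iKd_iff_without_contraction in H.
    destruct (interpolation H G1 G2 (Permutation_refl _)) as (C & H1 & H2 & HC).
    exists C; split; [| split].
    + now apply iKd_iff_without_contraction.
    + apply iKd_iff_without_contraction.
      reorder (C :: G2); exact H2.
    + intros p Hp; rewrite occurs_ctx_app; auto.
  - intros A B H; apply STL_RArr_inv, cut_elimination in H.
    destruct (interpolation H [A] [] (Permutation_refl _)) as (C & H1 & H2 & HC).
    exists C; split; [| split].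
    + apply STL_RArr; exact (iKd_with_STL H1).
    + apply STL_RArr; exact (iKd_with_STL H2).
    + intros p Hp; specialize (HC p Hp); solve_occurs.
Qed.
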